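(* Let $a,b,\mu,\nu\geq1$ and $0\leq\eta<1$ be real numbers such that $b\geq\psi(a,\eta)$, where $$\psi(a,\eta)=\frac{(a+1)+(1-\eta)(a+1-a^2)+\sqrt{\{(a+1)+(1-\eta)(a+1-a^2)\}^2+4a(1-\eta)(a+1)\{(1-\eta)(a+1)+2a+1\}}}{2a(1-\eta)(a+1)}.$$ Then $\mathbb{W}_{(\mu,a),(\nu,b)}(z)$ is starlike of order $\eta$ in $\mathbb{D}$, i.e. $\mathbb{W}_{(\mu,a),(\nu,b)}\in\mathcal{S}^*(\eta)$.
   Context: $\mathbb{D}=\{z\in\mathbb{C}:|z|<1\}$. The normalized four parameters Wright function is $$\mathbb{W}_{(\mu,a),(\nu,b)}(z)=\sum_{k=0}^{\infty}\frac{\Gamma(a)\Gamma(b)}{\Gamma(a+k\mu)\Gamma(b+k\nu)}\,z^{k+1}.$$ For $0\le\eta<1$, $\mathcal{S}^*(\eta)$ (starlike functions of order $\eta$) is the class of analytic functions $f$ on $\mathbb{D}$ with $f(0)=0$, $f'(0)=1$ and $\Re\left(zf'(z)/f(z)\right)>\eta$ for all $z\in\mathbb{D}$. *)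

(* Defs.v *)
From Stdlib Require Import Reals.
From Coquelicot Require Import Coquelicot.
Open Scope R_scope.

(* Euler's integral of the second kind, an improper Riemann integral on
   (0, +oo).  It converges, and so is the Gamma function, exactly for 0 < x. *)
Definition Gamma (x : R) : R :=
  RInt_gen (fun t : R => Rpower t (x - 1) * exp (- t))
    (at_right 0) (Rbar_locally p_infty).

Definition wright_coeff (mu a nu b : R) (k : nat) : R :=
  (Gamma a * Gamma b) / (Gamma (a + INR k * mu) * Gamma (b + INR k * nu)).

(* [iota] selects the sum of the series, which is unique whenever it exists. *)
Definition wright (mu a nu b : R) (z : C) : C :=
  @iota C_CompleteNormedModule
    (fun w : C =>
       is_series (fun k : nat => (RtoC (wright_coeff mu a nu b k) * z ^ (k + 1))%C) w).

Definition unit_disk (z : C) : Prop := Cmod z < 1.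

Definition analytic_on (D : C -> Prop) (f : C -> C) : Prop :=
  forall z : C, D z -> ex_derive f z.

(* [C_derive] is the complex derivative wherever [f] is complex differentiable.
   The quotient z f'(z) / f(z) is 0/0 at the origin, where its continuous
   extension is f'(0) = 1 > eta, so the inequality is required for z <> 0 only;
   there f z <> 0 makes the quotient a genuine one (division is total). *)
Definition starlike_of_order (eta : R) (f : C -> C) : Prop :=
  analytic_on unit_disk f /\
  f (RtoC 0) = RtoC 0 /\
  C_derive f (RtoC 0) = RtoC 1 /\
  forall z : C, unit_disk z -> z <> RtoC 0 ->
    f z <> RtoC 0 /\ Re (z * C_derive f z / f z)%C > eta.

Definition psi (a eta : R) : R :=
  ((a + 1) + (1 - eta) * (a + 1 - a ^ 2) +
   sqrt (((a + 1) + (1 - eta) * (a + 1 - a ^ 2)) ^ 2 +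
         4 * a * (1 - eta) * (a + 1) * ((1 - eta) * (a + 1) + 2 * a + 1)))
  / (2 * a * (1 - eta) * (a + 1)).

(* Main.v *)
(* Write f(z) = sum_k c_k z^(k+1) with c_k > 0 and c_0 = 1.  If
   sum_(k>=1) (k + 1 - eta) c_k <= 1 - eta, then
   |z f'/f - 1| <= sum k c_k |z|^k / (1 - sum c_k |z|^k) < 1 - eta on the disk.
   Since Gamma increases on [2, +oo) and mu, nu >= 1, c_k <= 1/((a)_k (b)_k).
   With (a)_k >= a (a+1)^(k-1), k/(a)_k <= 1/(a (a+1)^(k-2)) for k >= 2, and
   N = (a+1)(b+1), summing geometric series bounds the coefficient sum by
   ((N + a) + (1 - eta) N) / (a b (N - 1)), and requiring this to be at most
   1 - eta is a quadratic inequality in b whose larger root is psi(a, eta). *)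
Require Import Defs.
From Stdlib Require Import Reals Lra Lia ssreflect.
From Coquelicot Require Import Coquelicot.
Open Scope R_scope.

Lemma exp_le_mono (x y : R) : x <= y -> exp x <= exp y.
Proof.
  intros [H | ->]; [apply Rlt_le, exp_increasing, H | apply Rle_refl].
Qed.

(** * The Gamma function *)

(** The threshold 1 separates the two endpoints, so that intervals are always oriented as u < v. *)
Lemma near_0_infty (P : R * R -> Prop) :
  (forall u v, 0 < u -> u < 1 -> 1 < v -> P (u, v)) ->
  filter_prod (at_right 0) (Rbar_locally p_infty) P.
Proof.
  intros H.
  apply (Filter_prod _ _ _ (fun u => 0 < u < 1) (fun v => 1 < v)).
  - exists (mkposreal 1 Rlt_0_1); intros y Hy Hy0; simpl in Hy.
    rewrite /ball /= /AbsRing_ball /= /abs /minus /plus /opp /= in Hy.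
    apply Rabs_def2 in Hy; lra.
  - now exists 1.
  - intros u v [Hu0 Hu1] Hv; now apply H.
Qed.

Lemma ex_RInt_pos (f : R -> R) (u v : R) :
  (forall t, 0 < t -> continuous f t) -> 0 < u -> 0 < v -> ex_RInt f u v.
Proof.
  intros Hf Hu Hv; apply (@ex_RInt_continuous R_CompleteNormedModule); intros t Ht; apply Hf.
  apply Rlt_le_trans with (Rmin u v); [now apply Rmin_glb_lt | apply Ht].
Qed.

(** The limit is the supremum of the integrals over compact subintervals, which grow with the
    interval since f is nonnegative. The second conjunct keeps the supremum property for later lower
    bounds. *)
Lemma is_RInt_gen_nonneg_bounded (f : R -> R) (M : R) :
  (forall t, 0 < t -> continuous f t) -> (forall t, 0 < t -> 0 <= f t) ->
  (forall u v, 0 < u -> u <= v -> RInt f u v <= M) ->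
  exists l, is_RInt_gen f (at_right 0) (Rbar_locally p_infty) l /\
    forall u v, 0 < u -> u <= v -> RInt f u v <= l.
Proof.
  intros Hc Hp HM.
  set (E := fun y => exists u v, 0 < u /\ u <= v /\ y = RInt f u v).
  destruct (completeness E) as [l [Hub Hlub]].
  - exists M; intros y (u & v & Hu & Huv & ->); now apply HM.
  - exists (RInt f 1 1), 1, 1; repeat split; lra.
  - exists l; split.
    2: intros u v Hu Huv; apply Hub; exists u, v; auto.
    intros P [eps HP].
    assert (Hex : exists u v, 0 < u /\ u <= v /\ l - eps < RInt f u v).
    { apply Classical_Prop.NNPP; intros H.
      assert (l <= l - eps); [|destruct eps as [e He]; simpl in *; lra].
      apply Hlub; intros y (u & v & Hu & Huv & ->).
      apply Rnot_lt_le; intros Hlt; apply H; exists u, v; auto. }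
    destruct Hex as (u0 & v0 & Hu0 & Huv0 & Hl).
    (* Every interval containing [u0, v0] has its integral between l - eps and l. *)
    apply (Filter_prod _ _ _ (fun u => 0 < u <= u0) (fun v => v0 < v)).
    + exists (mkposreal u0 Hu0); intros y Hy Hy0; simpl in Hy.
      rewrite /ball /= /AbsRing_ball /= /abs /minus /plus /opp /= in Hy.
      apply Rabs_def2 in Hy; lra.
    + now exists v0.
    + intros u v [Hu Huu] Hv; simpl.
      exists (RInt f u v); split.
      * apply (@RInt_correct R_CompleteNormedModule), ex_RInt_pos; auto; lra.
      * apply HP.
        assert (H1 : RInt f u v <= l) by (apply Hub; exists u, v; repeat split; lra).
        assert (H2 : RInt f u v = RInt f u u0 + (RInt f u0 v0 + RInt f v0 v)).
        { rewrite -(RInt_Chasles f u u0 v); [ | apply ex_RInt_pos; auto; lra ..].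
          rewrite -(RInt_Chasles f u0 v0 v); [ | apply ex_RInt_pos; auto; lra ..].
          reflexivity. }
        assert (H3 : 0 <= RInt f u u0).
        { apply RInt_ge_0; auto. apply ex_RInt_pos; auto; lra. intros; apply Hp; lra. }
        assert (H4 : 0 <= RInt f v0 v).
        { apply RInt_ge_0; try lra. apply ex_RInt_pos; auto; lra. intros; apply Hp; lra. }
        rewrite /ball /= /AbsRing_ball /= /abs /minus /plus /opp /=.
        apply Rabs_def1; lra.
Qed.

(** The difference d = g - f is its own norm bound, so [RInt_gen_norm] gives |I| <= I for its
    integral I, whence I >= 0. *)
Lemma is_RInt_gen_le (f g : R -> R) (lf lg : R) :
  is_RInt_gen f (at_right 0) (Rbar_locally p_infty) lf ->
  is_RInt_gen g (at_right 0) (Rbar_locally p_infty) lg ->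
  (forall t, 0 < t -> f t <= g t) -> lf <= lg.
Proof.
  intros Hf Hg H.
  assert (Hd := is_RInt_gen_minus _ _ _ _ Hg Hf).
  assert (Hn : norm (minus lg lf) <= minus lg lf).
  { apply (RInt_gen_norm (Fa := at_right 0) (Fb := Rbar_locally p_infty)
             (fun t => minus (g t) (f t)) (fun t => minus (g t) (f t))); auto.
    - apply near_0_infty; simpl; intros; lra.
    - apply near_0_infty; intros u v Hu Hu1 Hv t Ht; simpl in Ht.
      rewrite /norm /= /abs /= /minus /plus /opp /= Rabs_pos_eq; [lra|].
      assert (f t <= g t) by (apply H; lra); lra. }
  rewrite /norm /= /abs /= /minus /plus /opp /= in Hn.
  assert (H0 := Rabs_pos (lg + - lf)); lra.
Qed.

(** * Euler's integral: convergence, functional equation, monotonicity *)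

Definition gamma_integrand (x t : R) : R := Rpower t (x - 1) * exp (- t).

Lemma gamma_integrand_pos (x t : R) : 0 < gamma_integrand x t.
Proof. apply Rmult_lt_0_compat; apply exp_pos. Qed.

(** This is the integration by parts behind the functional equation, in differential form; it also
    yields continuity of the integrand. *)
Lemma is_derive_gamma_integrand (x t : R) : 0 < t ->
  is_derive (gamma_integrand (x + 1)) t
    (x * gamma_integrand x t - gamma_integrand (x + 1) t).
Proof.
  intros Ht; unfold gamma_integrand.
  replace (x * (Rpower t (x - 1) * exp (- t)) - Rpower t (x + 1 - 1) * exp (- t))
    with (x * Rpower t (x - 1) * exp (- t) + Rpower t (x + 1 - 1) * (- exp (- t))) by ring.
  replace (x + 1 - 1) with x by ring.
  apply (is_derive_mult (fun t => Rpower t x) (fun t => exp (- t))).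
  - apply is_derive_Reals, derivable_pt_lim_power, Ht.
  - auto_derive; [trivial | ring].
  - intros; apply Rmult_comm.
Qed.

Lemma continuous_gamma_integrand (x t : R) : 0 < t -> continuous (gamma_integrand x) t.
Proof.
  intros Ht; apply (@ex_derive_continuous _ R_NormedModule).
  replace x with (x - 1 + 1) by ring.
  eexists; apply is_derive_gamma_integrand, Ht.
Qed.

Lemma ln_le_minus_1 (t : R) : 0 < t -> ln t <= t - 1.
Proof.
  intros Ht; assert (H := exp_ineq1_le (ln t)); rewrite exp_ln in H; lra.
Qed.

(** Apply ln s <= s - 1 at s = t / (2x): the scale 2x makes (x - 1) ln t grow with slope (x - 1) /
    (2x) < 1/2, which leaves half of the exponential decay. The constant K is (2x)^(x-1). *)
Lemma gamma_integrand_bound (x : R) : 1 <= x ->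
  exists K, forall t, 0 < t -> gamma_integrand x t <= K * exp (- t / 2).
Proof.
  intros Hx; exists (exp ((x - 1) * ln (2 * x))); intros t Ht.
  unfold gamma_integrand, Rpower; rewrite -!exp_plus.
  apply exp_le_mono.
  assert (H : ln (t * / (2 * x)) <= t * / (2 * x) - 1)
    by (apply ln_le_minus_1, Rmult_lt_0_compat; [lra | apply Rinv_0_lt_compat; lra]).
  rewrite ln_mult ?ln_Rinv in H; try lra.
  2: apply Rinv_0_lt_compat; lra.
  assert (H2 : (x - 1) * ln t <= (x - 1) * (ln (2 * x) + t * / (2 * x)))
    by (apply Rmult_le_compat_l; lra).
  assert (H3 : (x - 1) * (t * / (2 * x)) = t / 2 - t * / (2 * x)) by (field; lra).
  assert (H4 : 0 < t * / (2 * x))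
    by (apply Rmult_lt_0_compat; [lra | apply Rinv_0_lt_compat; lra]).
  lra.
Qed.

Lemma is_RInt_gen_Gamma (x : R) : 1 <= x ->
  is_RInt_gen (gamma_integrand x) (at_right 0) (Rbar_locally p_infty) (Gamma x) /\
  forall u v, 0 < u -> u <= v -> RInt (gamma_integrand x) u v <= Gamma x.
Proof.
  intros Hx.
  destruct (gamma_integrand_bound x Hx) as [K HK].
  (* The bound 2 K is the integral of K exp(-t/2) over (0, +oo). *)
  destruct (is_RInt_gen_nonneg_bounded (gamma_integrand x) (2 * K)) as (l & Hl & Hle).
  - apply continuous_gamma_integrand.
  - intros t _; apply Rlt_le, gamma_integrand_pos.
  - intros u v Hu Huv.
    assert (HI : is_RInt (fun t => K * exp (- t / 2)) u v
                   (- 2 * K * exp (- v / 2) - - 2 * K * exp (- u / 2))).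
    { apply (@is_RInt_derive R_CompleteNormedModule (fun t => - 2 * K * exp (- t / 2))).
      - intros t _; auto_derive; [trivial|]. unfold Rdiv; field.
      - intros t _; apply (@ex_derive_continuous _ R_NormedModule); auto_derive; trivial. }
    assert (H : RInt (gamma_integrand x) u v
                <= - 2 * K * exp (- v / 2) - - 2 * K * exp (- u / 2)).
    { rewrite -(is_RInt_unique _ _ _ _ HI); apply RInt_le; auto.
      - apply ex_RInt_pos; try lra; apply continuous_gamma_integrand.
      - eexists; apply HI.
      - intros t Ht; apply HK; lra. }
    assert (HK0 : 0 <= K).
    { assert (H1 := HK 1 Rlt_0_1); assert (H2 := gamma_integrand_pos x 1).
      assert (H3 := exp_pos (- (1) / 2)).
      apply Rnot_lt_le; intros H4; nra. }
    assert (exp (- u / 2) <= 1) by (rewrite -exp_0; apply exp_le_mono; lra).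
    assert (Hv := exp_pos (- v / 2)).
    nra.
  - assert (Gamma x = l) as -> by exact (is_RInt_gen_unique _ _ Hl).
    now split.
Qed.

Lemma Gamma_pos (x : R) : 1 <= x -> 0 < Gamma x.
Proof.
  intros Hx; destruct (is_RInt_gen_Gamma x Hx) as [_ H].
  apply Rlt_le_trans with (2 := H 1 2 Rlt_0_1 ltac:(lra)).
  apply RInt_gt_0; [lra | |]; intros t Ht.
  - apply gamma_integrand_pos.
  - apply continuous_gamma_integrand; lra.
Qed.

(** The integral of the derivative of t^x exp(-t) is computed twice: from its boundary values, which
    vanish, and from the explicit derivative. Uniqueness of the integral equates the results. *)
Lemma Gamma_succ (x : R) : 1 <= x -> Gamma (x + 1) = x * Gamma x.
Proof.
  intros Hx.
  destruct (is_RInt_gen_Gamma x Hx) as [H1 _].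
  destruct (is_RInt_gen_Gamma (x + 1) ltac:(lra)) as [H2 _].
  assert (H3 := is_RInt_gen_minus _ _ _ _ (is_RInt_gen_scal _ x _ H1) H2).
  assert (HD : forall t, 0 < t -> Derive (gamma_integrand (x + 1)) t =
                 minus (scal x (gamma_integrand x t)) (gamma_integrand (x + 1) t)).
  { intros t Ht; now apply is_derive_unique, is_derive_gamma_integrand. }
  assert (H0 : is_RInt_gen (Derive (gamma_integrand (x + 1)))
            (at_right 0) (Rbar_locally p_infty) (0 - 0)).
  { apply is_RInt_gen_Derive.
    - apply near_0_infty; simpl; intros u v Hu Hu1 Hv t [Ht _].
      rewrite Rmin_left in Ht; [|lra].
      eexists; apply is_derive_gamma_integrand; lra.
    - apply near_0_infty; simpl; intros u v Hu Hu1 Hv t [Ht _].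
      rewrite Rmin_left in Ht; [|lra].
      apply (continuous_ext_loc _ (fun t =>
        minus (scal x (gamma_integrand x t)) (gamma_integrand (x + 1) t))).
      (* Radius t keeps the ball inside (0, +oo), where the formula for [Derive] holds. *)
      + exists (mkposreal t ltac:(lra)); intros y Hy.
        rewrite /ball /= /AbsRing_ball /= /abs /minus /plus /opp /= in Hy.
        apply Rabs_def2 in Hy; symmetry; apply HD; lra.
      + apply @continuous_minus; [apply @continuous_scal_r|];
          apply continuous_gamma_integrand; lra.
    (* For 0 < t < 1 and x >= 1, t^x exp(-t) lies between 0 and t. *)
    - apply (filterlim_le_le (fun _ => 0) (gamma_integrand (x + 1)) (fun t => t) 0).
      + exists (mkposreal 1 Rlt_0_1); intros y Hy Hy0.
        rewrite /ball /= /AbsRing_ball /= /abs /minus /plus /opp /= in Hy.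
        apply Rabs_def2 in Hy.
        split; [apply Rlt_le, gamma_integrand_pos|].
        unfold gamma_integrand; replace (x + 1 - 1) with x by ring.
        rewrite -{3}(Rmult_1_r y); apply Rmult_le_compat; try (apply Rlt_le, exp_pos).
        * rewrite -{2}(exp_ln y Hy0); apply exp_le_mono.
          assert (ln y <= 0) by (assert (H := ln_le_minus_1 y Hy0); lra); nra.
        * rewrite -exp_0; apply exp_le_mono; lra.
      + apply filterlim_const.
      + intros P HP; apply filter_le_within, HP.
    - destruct (gamma_integrand_bound (x + 1) ltac:(lra)) as [K HK].
      apply (filterlim_le_le (fun _ => 0) (gamma_integrand (x + 1)) (fun t => K * exp (- t / 2)) 0).
      + exists 0; intros t Ht; split; [apply Rlt_le, gamma_integrand_pos | now apply HK].
      + apply filterlim_const.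
      + change (is_lim (fun t => K * exp (- t / 2)) p_infty 0).
        replace (Finite 0) with (Rbar_mult K 0) by (simpl; f_equal; ring).
        apply is_lim_scal_l.
        apply (is_lim_comp exp (fun t => - t / 2) p_infty 0 m_infty is_lim_exp_m).
        * intros P [M HM]; exists (- 2 * M); intros t Ht; apply HM; lra.
        * now exists 0. }
  assert (HE : is_RInt_gen (Derive (gamma_integrand (x + 1)))
            (at_right 0) (Rbar_locally p_infty) (minus (scal x (Gamma x)) (Gamma (x + 1)))).
  { refine (is_RInt_gen_ext _ _ _ _ H3).
    apply near_0_infty; simpl; intros u v Hu Hu1 Hv t [Ht _].
    rewrite Rmin_left in Ht; [|lra]; symmetry; apply HD; lra. }
  assert (HU := is_RInt_gen_unique _ _ HE).
  rewrite (is_RInt_gen_unique _ _ H0) in HU.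
  unfold minus, plus, opp, scal, mult in HU; simpl in HU; unfold mult in HU; simpl in HU; lra.
Qed.

(* Convexity of [s |-> t^s]: the slope beyond [s = 1] dominates the slope on [0, 1]. *)
Lemma gamma_integrand_convex (x y t : R) : 2 <= x -> x <= y -> 0 < t ->
  (y - x) * (gamma_integrand 2 t - gamma_integrand 1 t)
  <= gamma_integrand y t - gamma_integrand x t.
Proof.
  intros Hx Hxy Ht; unfold gamma_integrand.
  replace (1 - 1) with 0 by ring; replace (2 - 1) with 1 by ring.
  rewrite Rpower_O // Rpower_1 //.
  assert (He := exp_pos (- t)).
  cut ((y - x) * (t - 1) <= Rpower t (y - 1) - Rpower t (x - 1)); [nra|].
  unfold Rpower; set (L := ln t); assert (HL : exp L = t) by now apply exp_ln.
  replace ((y - 1) * L) with ((x - 1) * L + (y - x) * L) by ring.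
  rewrite exp_plus.
  (* The chain is t^(y-1) - t^(x-1) >= (y - x) L t^(x-1) >= (y - x) L t >= (y - x)(t - 1). The
     middle inequality uses x - 1 >= 1 and holds for either sign of L. *)
  assert (H1 := exp_ineq1_le ((y - x) * L)).
  assert (H2 := exp_pos ((x - 1) * L)).
  assert (H3 : L * t <= L * exp ((x - 1) * L)).
  { rewrite -HL; destruct (Rle_lt_dec 0 L) as [H0 | H0].
    - apply Rmult_le_compat_l; [lra | apply exp_le_mono; nra].
    - apply Rmult_le_compat_neg_l; [lra | apply exp_le_mono; nra]. }
  assert (H4 : t - 1 <= L * t).
  { assert (H := exp_ineq1_le (- L)); rewrite exp_Ropp HL in H.
    apply (Rmult_le_compat_r t) in H; [|lra].
    rewrite Rinv_l in H; lra. }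
  nra.
Qed.

(** Integrating the convexity inequality gives Gamma y - Gamma x >= (y - x)(Gamma 2 - Gamma 1), and
    the right side is zero. *)
Lemma Gamma_le (x y : R) : 2 <= x -> x <= y -> Gamma x <= Gamma y.
Proof.
  intros Hx Hxy.
  assert (HG : forall z, 1 <= z -> is_RInt_gen (gamma_integrand z) (at_right 0) (Rbar_locally p_infty) (Gamma z))
    by (intros z Hz; now apply is_RInt_gen_Gamma).
  assert (G1 := HG 1 ltac:(lra)); assert (G2 := HG 2 ltac:(lra)).
  assert (Gx := HG x ltac:(lra)); assert (Gy := HG y ltac:(lra)).
  assert (H21 := is_RInt_gen_scal _ (y - x) _ (is_RInt_gen_minus _ _ _ _ G2 G1)).
  assert (Hyx := is_RInt_gen_minus _ _ _ _ Gy Gx).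
  assert (H := is_RInt_gen_le _ _ _ _ H21 Hyx
    (fun t Ht => gamma_integrand_convex x y t Hx Hxy Ht)).
  assert (H2 : Gamma 2 = Gamma 1).
  { replace 2 with (1 + 1) by ring; rewrite Gamma_succ; [ring | lra]. }
  unfold minus, plus, opp, scal, mult in H; simpl in H; unfold mult in H; simpl in H.
  rewrite H2 in H; lra.
Qed.

(** * Wright coefficients *)

(** Iterating the functional equation produces the rising factorial a (a+1) ... (a+k), whose factors
    after the first are all at least a + 1. *)
Lemma Gamma_add_nat_ge (a : R) (k : nat) : 1 <= a ->
  Gamma a * (a * (a + 1) ^ k) <= Gamma (a + INR (S k)).
Proof.
  intros Ha; assert (HG := Gamma_pos a Ha).
  induction k as [|k IH].
  - simpl; rewrite Gamma_succ; lra.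
  - assert (Hk := pos_INR k).
    rewrite (S_INR (S k)) -Rplus_assoc Gamma_succ; rewrite S_INR in IH |- *; [|lra].
    replace (Gamma a * (a * (a + 1) ^ S k))
      with ((a + 1) * (Gamma a * (a * (a + 1) ^ k))) by (simpl; ring).
    apply Rmult_le_compat; [lra | | lra | exact IH].
    apply Rmult_le_pos; [lra|]; apply Rmult_le_pos; [lra|]; apply pow_le; lra.
Qed.

Lemma mul_div_le_inv (n g p d : R) :
  0 < p -> 0 < d -> n * (g * p) <= d -> n * (g / d) <= / p.
Proof.
  intros Hp Hd H.
  apply (Rmult_le_reg_l (p * d)); [now apply Rmult_lt_0_compat|].
  replace (p * d * (n * (g / d))) with (n * (g * p)) by (field; lra).
  replace (p * d * / p) with d by (field; lra).
  exact H.
Qed.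

(** One of the two factors of a Wright coefficient; for mu = 1 it is the inverse rising factorial
    1/(a)_k. *)
Definition gamma_ratio (a mu : R) (k : nat) : R := Gamma a / Gamma (a + INR k * mu).

Lemma gamma_ratio_pos (a mu : R) (k : nat) : 1 <= a -> 1 <= mu -> 0 < gamma_ratio a mu k.
Proof.
  intros Ha Hmu; assert (Hk := pos_INR k).
  apply Rdiv_lt_0_compat; apply Gamma_pos; nra.
Qed.

Lemma gamma_ratio_0 (a mu : R) : 1 <= a -> gamma_ratio a mu 0 = 1.
Proof.
  intros Ha; unfold gamma_ratio; simpl; rewrite Rmult_0_l Rplus_0_r.
  apply Rdiv_diag; assert (H := Gamma_pos a Ha); lra.
Qed.

(** The index [S k] puts both arguments in [2, +oo), where Gamma is known to increase. *)
Lemma Gamma_add_mul_ge (a mu : R) (k : nat) : 1 <= a -> 1 <= mu ->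
  Gamma (a + INR (S k)) <= Gamma (a + INR (S k) * mu).
Proof.
  intros Ha Hmu; assert (Hk := pos_INR k); rewrite S_INR.
  apply Gamma_le; nra.
Qed.

Lemma gamma_ratio_le (a mu : R) (k : nat) : 1 <= a -> 1 <= mu ->
  gamma_ratio a mu (S k) <= / (a * (a + 1) ^ k).
Proof.
  intros Ha Hmu; assert (Hk := pos_INR (S k)).
  rewrite -(Rmult_1_l (gamma_ratio _ _ _)); apply mul_div_le_inv.
  - apply Rmult_lt_0_compat; [lra | apply pow_lt; lra].
  - apply Gamma_pos; nra.
  - rewrite Rmult_1_l.
    apply Rle_trans with (2 := Gamma_add_mul_ge a mu k Ha Hmu); now apply Gamma_add_nat_ge.
Qed.

(* With [n = k + 2], the last factor [a + n - 1 >= n] of [(a)_n] absorbs [n]; this costs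
   one factor [a + 1] compared with [gamma_ratio_le]. *)
Lemma INR_mul_gamma_ratio_le (a mu : R) (k : nat) : 1 <= a -> 1 <= mu ->
  INR (S (S k)) * gamma_ratio a mu (S (S k)) <= / (a * (a + 1) ^ k).
Proof.
  intros Ha Hmu; assert (Hk := pos_INR k); assert (Hk' := pos_INR (S (S k))).
  assert (Hp : 0 < a * (a + 1) ^ k) by (apply Rmult_lt_0_compat; [lra | apply pow_lt; lra]).
  assert (HG := Gamma_pos a Ha).
  apply mul_div_le_inv; [exact Hp | apply Gamma_pos; nra |].
  apply Rle_trans with (2 := Gamma_add_mul_ge a mu (S k) Ha Hmu).
  assert (H1 := Gamma_add_nat_ge a k Ha).
  rewrite !(S_INR (S k)) -Rplus_assoc Gamma_succ; rewrite S_INR in H1 |- *; [|lra].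
  apply Rmult_le_compat; [lra | | lra | exact H1].
  apply Rmult_le_pos; lra.
Qed.

Lemma wright_coeff_ratio (mu a nu b : R) (k : nat) :
  wright_coeff mu a nu b k = gamma_ratio a mu k * gamma_ratio b nu k.
Proof.
  unfold wright_coeff, gamma_ratio, Rdiv; rewrite Rinv_mult; ring.
Qed.

Section WrightCoeff.

Variables (mu a nu b : R).
Hypotheses (ha : 1 <= a) (hb : 1 <= b) (hmu : 1 <= mu) (hnu : 1 <= nu).

Let q := / ((a + 1) * (b + 1)).

Lemma wright_coeff_pos (k : nat) : 0 < wright_coeff mu a nu b k.
Proof. rewrite wright_coeff_ratio; apply Rmult_lt_0_compat; now apply gamma_ratio_pos. Qed.

Lemma wright_coeff_0 : wright_coeff mu a nu b 0 = 1.
Proof. rewrite wright_coeff_ratio !gamma_ratio_0 //; ring. Qed.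

Lemma wright_coeff_S_le (k : nat) : wright_coeff mu a nu b (S k) <= / (a * b) * q ^ k.
Proof.
  rewrite wright_coeff_ratio /q pow_inv Rpow_mult_distr.
  assert (0 < (a + 1) ^ k) by (apply pow_lt; lra).
  assert (0 < (b + 1) ^ k) by (apply pow_lt; lra).
  replace (/ (a * b) * / ((a + 1) ^ k * (b + 1) ^ k))
    with (/ (a * (a + 1) ^ k) * / (b * (b + 1) ^ k)) by (field; repeat split; lra).
  apply Rmult_le_compat; try (apply Rlt_le, gamma_ratio_pos; assumption);
    now apply gamma_ratio_le.
Qed.

(** Only the a-factor absorbs the weight; the power of a + 1 that this costs is the numerator on the
    right. *)
Lemma INR_mul_wright_coeff_SS_le (k : nat) :
  INR (S (S k)) * wright_coeff mu a nu b (S (S k)) <= (a + 1) / (a * b) * q ^ S k.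
Proof.
  rewrite wright_coeff_ratio /q pow_inv Rpow_mult_distr.
  assert (0 < (a + 1) ^ k) by (apply pow_lt; lra).
  assert (0 < (b + 1) ^ S k) by (apply pow_lt; lra).
  replace ((a + 1) / (a * b) * / ((a + 1) ^ S k * (b + 1) ^ S k))
    with (/ (a * (a + 1) ^ k) * / (b * (b + 1) ^ S k))
    by (change ((a + 1) ^ S k) with ((a + 1) * (a + 1) ^ k); field; repeat split; lra).
  rewrite -Rmult_assoc; apply Rmult_le_compat.
  - apply Rmult_le_pos; [apply pos_INR | apply Rlt_le, gamma_ratio_pos; assumption].
  - apply Rlt_le, gamma_ratio_pos; assumption.
  - now apply INR_mul_gamma_ratio_le.
  - now apply gamma_ratio_le.
Qed.

Lemma ratio_bounds : 0 < q <= / 4.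
Proof.
  split; [apply Rinv_0_lt_compat | apply Rinv_le_contravar]; nra.
Qed.

(** The inductive step needs (n+1)^2 <= 2 n^2 for n = k + 1, which fails at n = 1 and n = 2, so the
    first cases are computed. *)
Lemma sqr_le_pow_2 (k : nat) : INR (S k) ^ 2 <= 4 * 2 ^ k.
Proof.
  assert (H : forall j, INR (S (3 + j)) ^ 2 <= 4 * 2 ^ (3 + j)).
  { induction j as [|j IH]; [simpl; lra|].
    replace (3 + S j)%nat with (S (3 + j)) by lia.
    rewrite S_INR; assert (H3 : 4 <= INR (S (3 + j))).
    { rewrite S_INR plus_INR; assert (H := pos_INR j); simpl; lra. }
    change (2 ^ S (3 + j)) with (2 * 2 ^ (3 + j)); nra. }
  destruct k as [|[|[|k]]]; try (simpl; lra).
  apply (H k).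
Qed.

(** Since q <= 1/4, the coefficients decay fast enough to beat 2^k, which dominates the quadratic
    weight. This weight controls the Taylor remainders when the series is differentiated. *)
Lemma ex_series_sqr_wright_coeff :
  ex_series (fun k => INR (S k) ^ 2 * wright_coeff mu a nu b k).
Proof.
  apply ex_series_incr_1.
  apply (@ex_series_le _ R_CompleteNormedModule _ (fun k => (8 * / (a * b)) * (/ 2) ^ k)).
  2: { apply (ex_series_scal_l (V := R_NormedModule)), ex_series_geom.
       rewrite Rabs_pos_eq; lra. }
  intros k.
  assert (Hc := wright_coeff_pos (S k)); assert (Hs := sqr_le_pow_2 (S k)).
  assert (H2 := pow2_ge_0 (INR (S (S k)))).
  rewrite [norm _]Rabs_pos_eq; [|apply Rmult_le_pos; [exact H2 | lra]].
  apply Rle_trans with ((8 * 2 ^ k) * (/ (a * b) * (/ 4) ^ k)).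
  - apply Rmult_le_compat; [exact H2 | lra | simpl in *; lra |].
    apply Rle_trans with (1 := wright_coeff_S_le k), Rmult_le_compat_l.
    + apply Rlt_le, Rinv_0_lt_compat; nra.
    + apply pow_incr; destruct ratio_bounds; lra.
  - right; replace (/ 4) with (/ 2 * / 2) by field.
    rewrite Rpow_mult_distr.
    assert (H : 2 ^ k * (/ 2) ^ k = 1) by (rewrite -Rpow_mult_distr Rinv_r ?pow1; lra).
    transitivity (8 * / (a * b) * (/ 2) ^ k * (2 ^ k * (/ 2) ^ k)); [ring | rewrite H; ring].
Qed.

(* [b] lies beyond the larger root of the quadratic
   [A b^2 - B b - C], whose nonnegativity is exactly this inequality. *)
Lemma psi_quadratic (eta : R) : eta < 1 -> b >= psi a eta ->
  ((a + 1) * (b + 1) + a) + (1 - eta) * ((a + 1) * (b + 1))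
  <= (1 - eta) * (a * b * ((a + 1) * (b + 1) - 1)).
Proof.
  unfold psi; intros He H.
  set (B := (a + 1) + (1 - eta) * (a + 1 - a ^ 2)) in *.
  set (C := (1 - eta) * (a + 1) + 2 * a + 1) in *.
  set (A := a * (1 - eta) * (a + 1)).
  assert (HA : 0 < A) by (unfold A; apply Rmult_lt_0_compat; nra).
  assert (HC : 0 < C) by (unfold C; nra).
  replace (4 * a * (1 - eta) * (a + 1) * C) with (4 * A * C) in H by (unfold A; ring).
  replace (2 * a * (1 - eta) * (a + 1)) with (2 * A) in H by (unfold A; ring).
  apply Rge_le in H; apply (Rle_div_l _ _ (2 * A)) in H; [|lra].
  assert (HD : 0 <= B ^ 2 + 4 * A * C) by nra.
  assert (Hs := sqrt_pos (B ^ 2 + 4 * A * C)).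
  assert (Hsq := pow2_sqrt _ HD).
  (* The hypothesis says 2 A b - B >= sqrt(B^2 + 4 A C) >= 0, so it may be squared; then 4 A (A b^2
     - B b - C) is the difference of the two sides. *)
  assert (Hq : B ^ 2 + 4 * A * C <= (b * (2 * A) - B) ^ 2).
  { rewrite -Hsq; apply pow_incr; lra. }
  assert (HQ : 0 <= A * b ^ 2 - B * b - C).
  { apply (Rmult_le_reg_l (4 * A)); [lra|]; nra. }
  unfold A, B, C in HQ; nra.
Qed.

Lemma wright_coeff_sum_le (eta : R) : 0 <= eta -> eta < 1 -> b >= psi a eta ->
  Series (fun k => (INR (S k) + (1 - eta)) * wright_coeff mu a nu b (S k)) <= 1 - eta.
Proof.
  intros He0 He1 Hpsi.
  set (t := fun k => (INR (S k) + (1 - eta)) * wright_coeff mu a nu b (S k)).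
  (* The geometric majorant [m k] bounds [t (S k)]. The term [t 0] is treated apart, because the
     weighted estimate starts at c_2. *)
  set (m := fun k => (a + 1 + (1 - eta)) / (a * b) * q * q ^ k).
  destruct ratio_bounds as [Hq0 Hq4].
  assert (Hab : 0 < / (a * b)) by (apply Rinv_0_lt_compat; nra).
  assert (Hm : is_series m ((a + 1 + (1 - eta)) / (a * b) * q * / (1 - q))).
  { apply (is_series_scal_l (V := R_NormedModule)), is_series_geom.
    rewrite Rabs_pos_eq; lra. }
  assert (Htm : forall k, 0 <= t (S k) <= m k).
  { intros k; unfold t, m.
    assert (Hc := wright_coeff_pos (S (S k))); assert (Hk := pos_INR (S (S k))).
    assert (H1 := wright_coeff_S_le (S k)).
    assert (H2 := INR_mul_wright_coeff_SS_le k).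
    simpl pow in H1, H2.
    split; [apply Rmult_le_pos; lra|].
    rewrite Rmult_plus_distr_r.
    replace ((a + 1 + (1 - eta)) / (a * b) * q * q ^ k)
      with ((a + 1) / (a * b) * (q * q ^ k) + (1 - eta) * (/ (a * b) * (q * q ^ k)))
      by (unfold Rdiv; ring).
    apply Rplus_le_compat; [exact H2 | apply Rmult_le_compat_l; lra]. }
  assert (Hex : ex_series (fun k => t (S k))).
  { apply (@ex_series_le _ R_CompleteNormedModule _ m); [|eexists; apply Hm].
    intros k; rewrite [norm _]Rabs_pos_eq; apply Htm. }
  rewrite Series_incr_1; [|now apply ex_series_incr_1].
  assert (H1 := Series_le _ _ Htm (ex_intro _ _ Hm)).
  rewrite (is_series_unique _ _ Hm) in H1.
  assert (H0 : t 0%nat <= (1 + (1 - eta)) * / (a * b)).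
  { unfold t; apply Rmult_le_compat_l; [simpl; lra|].
    assert (H := wright_coeff_S_le 0); simpl in H; lra. }
  apply Rle_trans with (1 := Rplus_le_compat _ _ _ _ H0 H1).
  assert (HQ := psi_quadratic eta He1 Hpsi).
  assert (HN : 0 < (a + 1) * (b + 1) - 1) by nra.
  (* With q = 1/N, q / (1 - q) = 1 / (N - 1), which puts both bounds over the common denominator a b
     (N - 1). *)
  replace (_ + _) with
    (((a + 1) * (b + 1) + a + (1 - eta) * ((a + 1) * (b + 1)))
     / (a * b * ((a + 1) * (b + 1) - 1))).
  - apply Rle_div_l; [|exact HQ].
    apply Rmult_lt_0_compat; [nra | exact HN].
  - unfold q; field; repeat split; nra.
Qed.

End WrightCoeff.

(** * Starlikeness from positive coefficients *)

Lemma is_series_norm_le {K : AbsRing} {V : NormedModule K} (a : nat -> V) (b : nat -> R)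
    (la : V) (lb : R) :
  is_series a la -> is_series b lb -> (forall n, norm (a n) <= b n) -> norm la <= lb.
Proof.
  intros Ha Hb Hab.
  apply (filterlim_le (F := eventually) (fun n => norm (sum_n a n)) (sum_n b) (norm la) lb).
  - exists 0%nat; intros n _.
    apply Rle_trans with (1 := norm_sum_n_m a 0 n), sum_n_m_le, Hab.
  - apply (filterlim_comp _ _ _ _ _ _ _ _ Ha (filterlim_norm la)).
  - exact Hb.
Qed.

Lemma Cmod_pow_le_1 (z : C) (n : nat) : Cmod z <= 1 -> Cmod (z ^ n)%C <= 1.
Proof.
  intros Hz; rewrite Cmod_pow -(pow1 n); apply pow_incr; split; [apply Cmod_ge_0 | exact Hz].
Qed.

Lemma Cmod_pow_sub_le (z w : C) (n : nat) : Cmod z <= 1 -> Cmod w <= 1 ->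
  Cmod (w ^ n - z ^ n)%C <= INR n * Cmod (w - z)%C.
Proof.
  intros Hz Hw; induction n as [|n IH].
  - replace (w ^ 0 - z ^ 0)%C with (RtoC 0) by (simpl; ring).
    rewrite Cmod_0 /= Rmult_0_l; apply Rle_refl.
  - replace (w ^ S n - z ^ S n)%C with (w ^ n * (w - z) + (w ^ n - z ^ n) * z)%C
      by (simpl; ring).
    rewrite S_INR; apply Rle_trans with (1 := Cmod_triangle _ _); rewrite !Cmod_mult.
    assert (H1 := Cmod_pow_le_1 w n Hw).
    assert (H2 := Cmod_ge_0 (w - z)%C); assert (H3 := Cmod_ge_0 (w ^ n - z ^ n)%C).
    nra.
Qed.

(** With R_n the first-order remainder of w^n at z, R_(n+1) = z R_n + (w - z)(w^n - z^n). The
    previous lemma turns this into n^2 + n <= (n+1)^2; the constant is crude but summable against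
    c. *)
Lemma Cmod_pow_taylor_le (z w : C) (n : nat) : Cmod z <= 1 -> Cmod w <= 1 ->
  Cmod (w ^ S n - z ^ S n - RtoC (INR (S n)) * z ^ n * (w - z))%C
  <= INR (S n) ^ 2 * Cmod (w - z)%C ^ 2.
Proof.
  intros Hz Hw; induction n as [|n IH].
  - replace (_ - _ - _)%C with (RtoC 0) by (simpl; ring).
    rewrite Cmod_0; assert (H := pow2_ge_0 (Cmod (w - z)%C)); simpl INR; lra.
  - set (r := (w ^ S n - z ^ S n - RtoC (INR (S n)) * z ^ n * (w - z))%C) in *.
    replace (w ^ S (S n) - z ^ S (S n) - RtoC (INR (S (S n))) * z ^ S n * (w - z))%C
      with (z * r + (w - z) * (w ^ S n - z ^ S n))%C
      by (unfold r; rewrite (S_INR (S n)) RtoC_plus; simpl; ring).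
    apply Rle_trans with (1 := Cmod_triangle _ _); rewrite !Cmod_mult.
    assert (H1 := Cmod_pow_sub_le z w (S n) Hz Hw).
    assert (H2 := Cmod_ge_0 (w - z)%C); assert (H3 := Cmod_ge_0 r).
    assert (H4 := pos_INR (S n)).
    rewrite (S_INR (S n)).
    apply Rle_trans with
      (INR (S n) ^ 2 * Cmod (w - z)%C ^ 2 + Cmod (w - z)%C * (INR (S n) * Cmod (w - z)%C)).
    + apply Rplus_le_compat; [nra | now apply Rmult_le_compat_l].
    + nra.
Qed.

(** * Power series with nonnegative coefficients *)

Section PositiveCoefficients.

Variable c : nat -> R.
Hypotheses (c_ge0 : forall k, 0 <= c k) (c_0 : c 0%nat = 1)
  (c_sqr : ex_series (fun k => INR (S k) ^ 2 * c k)).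

(** It has the same shape as [wright], so that taking [wright_coeff mu a nu b] for c gives
    [wright mu a nu b] by conversion. *)
Definition series_sum (z : C) : C :=
  @iota C_CompleteNormedModule
    (fun w : C => is_series (fun k : nat => (RtoC (c k) * z ^ (k + 1))%C) w).

Lemma INR_S_ge_1 (k : nat) : 1 <= INR (S k).
Proof. rewrite S_INR; assert (H := pos_INR k); lra. Qed.

Lemma ex_series_weight (u : nat -> R) :
  (forall k, 0 <= u k <= INR (S k) ^ 2) -> ex_series (fun k => u k * c k).
Proof.
  intros Hu; refine (@ex_series_le _ R_CompleteNormedModule _ _ _ c_sqr); intros k.
  destruct (Hu k) as [Hu0 Hu1]; assert (Hk := c_ge0 k).
  rewrite [norm _]Rabs_pos_eq; [now apply Rmult_le_compat_r | now apply Rmult_le_pos].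
Qed.

Lemma ex_series_weight_S (u : nat -> R) :
  (forall k, 0 <= u k <= INR (S (S k)) ^ 2) -> ex_series (fun k => u k * c (S k)).
Proof.
  intros Hu.
  (* Padding the weight with 0 at index 0 reduces the shifted series to the unshifted one. *)
  assert (H := ex_series_weight (fun k => match k with O => 0 | S j => u j end)).
  apply (ex_series_incr_1 (V := R_NormedModule)) in H; [exact H|].
  intros [|k]; [simpl; lra | apply Hu].
Qed.

Lemma is_series_series_sum (z : C) : Cmod z <= 1 ->
  is_series (V := C_NormedModule) (fun k : nat => (RtoC (c k) * z ^ (k + 1))%C) (series_sum z).
Proof.
  intros Hz.
  assert (Hex : ex_series (V := C_NormedModule) (fun k => (RtoC (c k) * z ^ (k + 1))%C)).
  { apply (@ex_series_le _ C_CompleteNormedModule _ (fun k => 1 * c k)).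
    - intros k; rewrite -[norm _]/(Cmod _) Cmod_mult Cmod_R Rabs_pos_eq //.
      assert (H := Cmod_pow_le_1 z (k + 1) Hz); assert (H' := c_ge0 k); nra.
    - apply ex_series_weight; intros k; assert (H := INR_S_ge_1 k); nra. }
  destruct Hex as [l Hl].
  assert (series_sum z = l) as ->; [|exact Hl].
  apply (@iota_filterlim_locally _ C_CompleteNormedModule _ eventually _ _ _ Hl).
Qed.

Lemma ex_series_deriv (z : C) : Cmod z <= 1 ->
  ex_series (V := C_NormedModule) (fun k => (RtoC (c k) * (RtoC (INR (S k)) * z ^ k))%C).
Proof.
  intros Hz.
  apply (@ex_series_le _ C_CompleteNormedModule _ (fun k => INR (S k) * c k)).
  - intros k; rewrite -[norm _]/(Cmod _) !Cmod_mult !Cmod_R !Rabs_pos_eq //; [|apply pos_INR].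
    assert (H := Cmod_pow_le_1 z k Hz); assert (H' := c_ge0 k); assert (H2 := INR_S_ge_1 k).
    rewrite (Rmult_comm (INR _) (c k)).
    apply Rmult_le_compat_l; [lra|]; nra.
  - apply ex_series_weight; intros k; assert (H := INR_S_ge_1 k); nra.
Qed.

(** Summing the Taylor bounds termwise gives a remainder of at most M |w - z|^2, with M the sum of
    (k+1)^2 c_k, so termwise differentiation is justified directly. *)
Lemma is_derive_series_sum (z l : C) : Cmod z < 1 ->
  is_series (V := C_NormedModule) (fun k => (RtoC (c k) * (RtoC (INR (S k)) * z ^ k))%C) l ->
  is_derive (V := C_NormedModule) series_sum z l.
Proof.
  intros Hz Hl.
  set (M := Series (fun k => INR (S k) ^ 2 * c k)).
  assert (Htaylor : forall w, Cmod w <= 1 ->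
    Cmod (series_sum w - series_sum z - (w - z) * l)%C <= Cmod (w - z)%C ^ 2 * M).
  { intros w Hw.
    assert (Hs := is_series_minus _ _ _ _
      (is_series_minus _ _ _ _ (is_series_series_sum w Hw) (is_series_series_sum z (Rlt_le _ _ Hz)))
      (is_series_scal (w - z)%C _ _ Hl)).
    refine (is_series_norm_le _ _ _ _ Hs
      (is_series_scal_l (V := R_NormedModule) (Cmod (w - z)%C ^ 2) _ _ (Series_correct _ c_sqr)) _).
    intros k.
    match goal with |- norm ?x <= _ => replace x with
      (RtoC (c k) * (w ^ S k - z ^ S k - RtoC (INR (S k)) * z ^ k * (w - z)))%C end.
    - rewrite -[norm _]/(Cmod _) Cmod_mult Cmod_R Rabs_pos_eq //.
      assert (H := Cmod_pow_taylor_le z w k (Rlt_le _ _ Hz) Hw); assert (H' := c_ge0 k).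
      apply (Rmult_le_compat_l (c k)) in H; [|exact H'].
      apply Rle_trans with (1 := H); right.
      rewrite /scal /= /mult /=; ring.
    - rewrite Nat.add_1_r; rewrite /plus /opp /scal /= /mult /=; ring. }
  split; [apply is_linear_scal_l|].
  intros x Hx eps; apply (is_filter_lim_locally_unique (V := AbsRing_NormedModule C_AbsRing)) in Hx; subst x.
  assert (HM : 0 <= M).
  { unfold M; rewrite -(Rmult_0_l (Series (fun k => INR (S k) ^ 2 * c k))) -Series_scal_l.
    apply Series_le; [|exact c_sqr].
    intros k; assert (H := c_ge0 k); assert (H2 := pow2_ge_0 (INR (S k))).
    rewrite Rmult_0_l; split; [lra | now apply Rmult_le_pos]. }
  (* The first bound keeps w in the closed disk, where the Taylor estimate holds; the second gives M
     |w - z| <= eps. *)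
  assert (Hd : 0 < Rmin (1 - Cmod z) (eps / (M + 1))).
  { apply Rmin_glb_lt; [lra | apply Rdiv_lt_0_compat; [apply cond_pos | lra]]. }
  exists (mkposreal _ Hd); intros w Hw.
  change (Cmod (w - z)%C < Rmin (1 - Cmod z) (eps / (M + 1))) in Hw.
  assert (Hw1 := Rlt_le_trans _ _ _ Hw (Rmin_l _ _)).
  assert (Hw2 := Rlt_le_trans _ _ _ Hw (Rmin_r _ _)).
  assert (Hwle : Cmod w <= 1).
  { replace w with ((w - z) + z)%C by ring.
    apply Rle_trans with (1 := Cmod_triangle _ _); lra. }
  assert (HT := Htaylor w Hwle).
  apply Rle_trans with (1 := HT).
  change (Cmod (w - z)%C ^ 2 * M <= eps * Cmod (w - z)%C).
  apply Rlt_div_r in Hw2; [|lra].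
  assert (H0 := Cmod_ge_0 (w - z)%C).
  simpl pow; nra.
Qed.

(** Isolates the leading term of a series; it serves for f(z) - z, for z f'(z) - f(z) and for f'(0)
    - 1. *)
Lemma Cmod_sub_head_le (u : nat -> C) (b : nat -> R) (l : C) :
  is_series (V := C_NormedModule) u l -> ex_series b ->
  (forall k, Cmod (u (S k)) <= b k) -> Cmod (l - u 0%nat)%C <= Series b.
Proof.
  intros Hu Hb H.
  refine (is_series_norm_le (V := C_NormedModule) (fun k => u (S k)) b _ _ _ (Series_correct _ Hb) H).
  apply is_series_incr_1.
  match goal with |- is_series _ ?x => replace x with l end; [exact Hu|].
  rewrite /plus /=; ring.
Qed.

Lemma Cmod_pow_S_le_sqr (z : C) (k : nat) : Cmod z <= 1 -> Cmod (z ^ S (S k))%C <= Cmod z ^ 2.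
Proof.
  intros Hz; replace (z ^ S (S k))%C with (z * z * z ^ k)%C by (simpl; ring).
  rewrite !Cmod_mult; assert (H := Cmod_pow_le_1 z k Hz); assert (H0 := Cmod_ge_0 z); nra.
Qed.

Lemma Cmod_series_sum_sub_le (z : C) : Cmod z <= 1 ->
  Cmod (series_sum z - z)%C <= Cmod z ^ 2 * Series (fun k => c (S k)).
Proof.
  intros Hz; rewrite -Series_scal_l.
  replace z with (RtoC (c 0%nat) * z ^ (0 + 1))%C at 2 by (rewrite c_0 /=; ring).
  apply (Cmod_sub_head_le _ _ _ (is_series_series_sum z Hz)).
  - apply (ex_series_weight_S (fun _ => Cmod z ^ 2)); intros k.
    assert (H := INR_S_ge_1 (S k)); assert (H0 := Cmod_ge_0 z); nra.
  - intros k; rewrite Nat.add_1_r Cmod_mult Cmod_R Rabs_pos_eq // Rmult_comm.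
    apply Rmult_le_compat_r; [apply c_ge0 | now apply Cmod_pow_S_le_sqr].
Qed.

Lemma Cmod_deriv_sub_le (z l : C) : Cmod z <= 1 ->
  is_series (V := C_NormedModule) (fun k => (RtoC (c k) * (RtoC (INR (S k)) * z ^ k))%C) l ->
  Cmod (z * l - series_sum z)%C <= Cmod z ^ 2 * Series (fun k => INR (S k) * c (S k)).
Proof.
  intros Hz Hl; rewrite -Series_scal_l.
  assert (Hs := is_series_minus _ _ _ _ (is_series_scal z _ _ Hl) (is_series_series_sum z Hz)).
  refine (Rle_trans _ _ _ _ (Cmod_sub_head_le _ _ _ Hs _ _)).
  (* The head of z f' - f vanishes, as its k-th term is k c_k z^(k+1). *)
  - right; f_equal; rewrite /plus /opp /scal /= /mult /=; ring.
  - apply (ex_series_ext (fun k => (Cmod z ^ 2 * INR (S k)) * c (S k))); [intros; simpl; ring|].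
    apply ex_series_weight_S; intros k.
    assert (H := INR_S_ge_1 k); assert (H0 := Cmod_ge_0 z); rewrite (S_INR (S k)); split; [nra|].
    apply Rle_trans with (1 * INR (S k)); [apply Rmult_le_compat_r; nra | nra].
  - intros k.
    match goal with |- Cmod ?x <= _ => replace x with
      (RtoC (INR (S k) * c (S k)) * z ^ S (S k))%C end.
    + assert (H := INR_S_ge_1 k); assert (H0 := c_ge0 (S k)).
      rewrite Cmod_mult Cmod_R Rabs_pos_eq; [|nra]; rewrite Rmult_comm.
      apply Rmult_le_compat_r; [nra | now apply Cmod_pow_S_le_sqr].
    + rewrite Nat.add_1_r (S_INR (S k)) RtoC_mult RtoC_plus.
      rewrite /plus /opp /scal /= /mult /=; ring.
Qed.

Lemma deriv_series_at_0 (l : C) :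
  is_series (V := C_NormedModule) (fun k => (RtoC (c k) * (RtoC (INR (S k)) * RtoC 0 ^ k))%C) l ->
  l = RtoC 1.
Proof.
  intros Hl; apply Ceq_minus, Cmod_eq_0, Rle_antisym; [|apply Cmod_ge_0].
  (* The head survives at the origin because [RtoC 0 ^ 0] is 1; all later terms are zero. *)
  replace (RtoC 1) with (RtoC (c 0%nat) * (RtoC (INR 1) * RtoC 0 ^ 0))%C by (rewrite c_0 /=; ring).
  assert (H0 : ex_series (fun k => 0 * c (S k))).
  { apply (ex_series_weight_S (fun _ => 0)); intros k; split; [lra | apply pow2_ge_0]. }
  refine (Rle_trans _ _ _ (Cmod_sub_head_le _ _ _ Hl H0 _) _); [|rewrite Series_scal_l; lra].
  intros k; rewrite !Cmod_mult Cmod_pow Cmod_0 /=; right; ring.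
Qed.

Lemma starlike_of_coeff_sum (eta : R) : eta < 1 ->
  Series (fun k => (INR (S k) + (1 - eta)) * c (S k)) <= 1 - eta ->
  starlike_of_order eta series_sum.
Proof.
  intros Heta Hsum.
  assert (Hd : forall z, Cmod z < 1 -> exists l,
    is_derive (V := C_NormedModule) series_sum z l /\
    is_series (V := C_NormedModule) (fun k => (RtoC (c k) * (RtoC (INR (S k)) * z ^ k))%C) l).
  { intros z Hz; destruct (ex_series_deriv z (Rlt_le _ _ Hz)) as [l Hl].
    exists l; split; [now apply is_derive_series_sum | exact Hl]. }
  set (S1 := Series (fun k => INR (S k) * c (S k))).
  set (S2 := Series (fun k => c (S k))).
  assert (E1 : ex_series (fun k => INR (S k) * c (S k))).
  { apply ex_series_weight_S; intros k; assert (H := INR_S_ge_1 k).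
    rewrite (S_INR (S k)); nra. }
  assert (E2 : ex_series (fun k => c (S k))).
  { apply (ex_series_ext (V := R_NormedModule) (fun k => 1 * c (S k))); [intros; apply Rmult_1_l|].
    apply ex_series_weight_S; intros k; assert (H := INR_S_ge_1 (S k)); nra. }
  (* S1 will bound z f' - f and S2 will bound f - z; both series converge, so the hypothesis
     splits. *)
  assert (HS : S1 + (1 - eta) * S2 <= 1 - eta).
  { apply Rle_trans with (2 := Hsum); right; unfold S1, S2.
    rewrite -Series_scal_l -Series_plus //.
    - apply Series_ext; intros k; ring.
    - now apply (ex_series_scal_l (V := R_NormedModule)). }
  assert (Hpos : forall u, ex_series u -> (forall k, 0 <= u k) -> 0 <= Series u).
  { intros u Hu Hu0; rewrite -(Rmult_0_l (Series u)) -Series_scal_l.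
    apply Series_le; [intros k; rewrite Rmult_0_l; split; [lra | apply Hu0] | exact Hu]. }
  assert (H1 : 0 <= S1).
  { apply Hpos; [exact E1 | intros k; apply Rmult_le_pos; [apply pos_INR | apply c_ge0]]. }
  assert (H2 : 0 <= S2) by (apply Hpos; [exact E2 | intros k; apply c_ge0]).
  split; [|split; [|split]].
  - intros z Hz; destruct (Hd z Hz) as [l [Hl _]]; now exists l.
  - assert (H := Cmod_series_sum_sub_le (RtoC 0)); rewrite Cmod_0 in H.
    replace (series_sum (RtoC 0)) with (series_sum (RtoC 0) - RtoC 0)%C by ring.
    apply Cmod_eq_0, Rle_antisym; [|apply Cmod_ge_0].
    apply Rle_trans with (1 := H Rle_0_1); right; ring.
  - destruct (Hd (RtoC 0)) as [l [Hl Hs]]; [rewrite Cmod_0; lra|].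
    rewrite (is_C_derive_unique _ _ _ Hl); now apply deriv_series_at_0.
  - intros z Hz Hz0; unfold unit_disk in Hz.
    destruct (Hd z Hz) as [l [Hl Hs]].
    rewrite (is_C_derive_unique _ _ _ Hl).
    assert (B1 := Cmod_deriv_sub_le z l (Rlt_le _ _ Hz) Hs); fold S1 in B1.
    assert (B2 := Cmod_series_sum_sub_le z (Rlt_le _ _ Hz)); fold S2 in B2.
    assert (Hr := proj1 (Cmod_gt_0 z) Hz0).
    set (r := Cmod z) in *; set (f := series_sum z) in *.
    assert (Hlow : r - r ^ 2 * S2 <= Cmod f).
    { assert (H := Cmod_triangle f (- (f - z))%C); rewrite Cmod_opp in H.
      replace (f + - (f - z))%C with z in H by ring; fold r in H; lra. }
    (* Dropping S1 >= 0 leaves (1 - eta) S2 <= 1 - eta, and 1 - eta > 0. *)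
    assert (HS2 : S2 <= 1) by nra.
    assert (Hfpos : 0 < r - r ^ 2 * S2) by nra.
    assert (Hf : f <> RtoC 0) by (apply Cmod_gt_0; lra).
    split; [exact Hf|].
    assert (Hq : Cmod ((z * l - f) / f)%C < 1 - eta).
    { rewrite Cmod_div //; apply Rlt_div_l; [lra|].
      apply Rle_lt_trans with (1 := B1).
      apply Rlt_le_trans with ((1 - eta) * (r - r ^ 2 * S2));
        [|apply Rmult_le_compat_l; lra].
      (* Strictness comes from 0 < r < 1: the estimates carry r^2 while the leading term carries
         only r. *)
      assert (r * (r * (S1 + (1 - eta) * S2)) < r * (1 - eta)); [|nra].
      apply Rmult_lt_compat_l; [exact Hr | nra]. }
    replace (z * l / f)%C with (1 + (z * l - f) / f)%C by (field; exact Hf).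
    assert (Hre := re_le_Cmod ((z * l - f) / f)%C).
    apply Rabs_le_between in Hre.
    change (Re (1 + (z * l - f) / f)%C) with (1 + Re ((z * l - f) / f)%C).
    lra.
Qed.

End PositiveCoefficients.

Theorem theorem4p2 (a b mu nu eta : R)
  (ha : 1 <= a) (hb : 1 <= b) (hmu : 1 <= mu) (hnu : 1 <= nu)
  (heta0 : 0 <= eta) (heta1 : eta < 1)
  (hpsi : b >= psi a eta) :
  starlike_of_order eta (wright mu a nu b).
Proof.
  apply (starlike_of_coeff_sum (wright_coeff mu a nu b)).
  - intros k; now apply Rlt_le, wright_coeff_pos.
  - now apply wright_coeff_0.
  - now apply ex_series_sqr_wright_coeff.
  - exact heta1.
  - now apply wright_coeff_sum_le.
Qed.
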